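(* The strong independence number of $3\text{-}QI(8,2)$ is $\alpha_S(3\text{-}QI(8,2))=5$.
   Context: Definition of $3\text{-}QI(8,2)$: its vertices are all binary strings of length $8$ with entries in $\{0,1\}$ whose first entry is $0$ and in which each symbol occurs at least $4$ (hence exactly $4$) times; equivalently, the unordered partitions $\{X,\overline{X}\}$ of $[8]=\{1,\dots,8\}$ with $|X|=|\overline{X}|=4$. Three vertices form a hyperedge if and only if they are $3$-qualitatively independent: for every $(g_1,g_2,g_3)\in\{0,1\}^3$ there is an index $j$ with $v_i[j]=g_i$ for $i=1,2,3$ (equivalently, all eight triple intersections of parts, one part from each partition, are non-empty). There are no other hyperedges. A set of vertices of a hypergraph $H$ is strongly independent if no two of its (distinct) elements belong to a common hyperedge of $H$. The strong independence number $\alpha_S(H)$ is the maximum cardinality of a strongly independent set of $H$. *)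

(* Defs.v *)
From HB Require Import structures.
From mathcomp Require Import all_boot.

Set Implicit Arguments.
Unset Strict Implicit.
Unset Printing Implicit Defensive.

(* A finite hypergraph with vertex type V is given by its set of hyperedges. *)
Definition hypergraph (V : finType) := {set {set V}}.

Definition strongly_independent (V : finType) (H : hypergraph V)
    (S : {set V}) : bool :=
  [forall x in S, forall y in S,
     (x != y) ==> ~~ [exists e in H, (x \in e) && (y \in e)]].

Definition strong_independence_number (V : finType) (H : hypergraph V) : nat :=
  \max_(S : {set V} | strongly_independent H S) #|S|.

(* Positions 1, ..., 8 of a string are numbered 0, ..., 7 in 'I_8. *)
Definition QI_string (v : 8.-tuple 'I_2) : bool :=
  (tnth v ord0 == ord0) && [forall a : 'I_2, 4 <= count_mem a v].

Definition QI_vertex := {v : 8.-tuple 'I_2 | QI_string v}.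

Definition qual_indep3 (v1 v2 v3 : 8.-tuple 'I_2) : bool :=
  [forall g1 : 'I_2, forall g2 : 'I_2, forall g3 : 'I_2,
     exists j : 'I_8,
       [&& tnth v1 j == g1, tnth v2 j == g2 & tnth v3 j == g3]].

(* The 3-uniform hypergraph 3-QI(8,2). *)
Definition QI3_8_2 : hypergraph QI_vertex :=
  [set e : {set QI_vertex} | (#|e| == 3) &&
     [exists v1 : QI_vertex, exists v2 : QI_vertex, exists v3 : QI_vertex,
        (e == [set v1; v2; v3]) && qual_indep3 (val v1) (val v2) (val v3)]].

(* Main.v *)
Require Import Defs.
From HB Require Import structures.
From mathcomp Require Import all_boot.

(** Two vertices that agree in six or in two positions have a symbol pair
occurring at a single position; no third string takes both symbols there, so
they share no hyperedge.  The five strings whose zeros are the positions 0, 1, 2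
and one more position are of this kind ([five_words_no_common_edge]), hence the
number is at least 5.

For the upper bound, identify the eight positions with the space F_2^3.  The
seven vertices that are affine functions on this space ([affine_word]) lie
pairwise in common hyperedges: two distinct such vertices and a suitable third
affine function are the coordinates of an affine bijection onto {0,1}^3.  A
strongly independent set S therefore contains at most one of them, and the same
holds after any permutation of the positions.  Rotating the positions 0, 1, 2
and the positions 3, ..., 7 separately gives 15 such families of vertices.  The
alternating group A_8 is isomorphic to GL_4(2); there, vertices become the 35
lines of PG(3,2), the 15 families become its 15 points, and the product of a
3-cycle and a 5-cycle becomes a Singer cycle, which permutes the points in a
single orbit.  Since a line has three points, every vertex lies in three of the
families ([three_families]), and counting the incidences with S gives
3 |S| <= 15 ([strongly_independent_le5]).  In the same picture, strongly
independent sets are partial spreads of lines, and the five strings above form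
a spread.

Vertices are replaced by words of bits, on which the finite facts above
can be evaluated ([in_common_edge] translates the hyperedges). *)

(** * Vertices as words of bits *)

Definition bit (a : 'I_2) : bool := a == 1 :> nat.
Definition unbit (b : bool) : 'I_2 := inord b.

Lemma unbitK : cancel unbit bit.
Proof. by case; rewrite /bit /unbit inordK. Qed.

Lemma bitK : cancel bit unbit.
Proof.
by move=> a; apply: val_inj; rewrite /bit /unbit; case: a => [[|[]]] // ?;
   rewrite /= inordK.
Qed.

Definition word (v : 8.-tuple 'I_2) : bitseq := map bit v.

Lemma size_word v : size (word v) = 8.
Proof. by rewrite size_map size_tuple. Qed.

Lemma word_inj : injective word.
Proof. by move=> u v /(inj_map (can_inj bitK)) /val_inj. Qed.

Lemma nth_word v (j : 'I_8) : nth false (word v) j = bit (tnth v j).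
Proof. by rewrite (nth_map ord0) ?size_tuple // (tnth_nth ord0). Qed.

Lemma count_word v a : count_mem (bit a) (word v) = count_mem a v.
Proof.
rewrite count_map; apply: eq_count => b /=.
exact: (inj_eq (can_inj bitK)).
Qed.

Lemma count_bits (w : bitseq) :
  count_mem true w + count_mem false w = size w.
Proof.
by rewrite -(count_predC (pred1 true)); congr (_ + _); apply: eq_count; case.
Qed.

Definition vertex_words : seq bitseq :=
  [seq false :: w | w <- permutations (nseq 4 true ++ nseq 3 false)].

Lemma mem_vertex_words w :
  (w \in vertex_words) =
  [&& ~~ head true w, count_mem true w == 4 & count_mem false w == 4].
Proof.
case: w => [|b w]; first by apply/mapP => -[].
have -> : (b :: w \in vertex_words) =
          ~~ b && perm_eq w (nseq 4 true ++ nseq 3 false).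
  rewrite -mem_permutations; case: b => /=; first by apply/mapP => -[].
  by rewrite mem_map // => u v [].
case: b => //=; rewrite add0n add1n eqSS.
apply/idP/andP => [/permP Ew | [/eqP Et /eqP Ef]]; first by rewrite !Ew.
by apply/allP => -[] _ /=; rewrite ?Et ?Ef.
Qed.

Lemma QI_stringE v : QI_string v = (word v \in vertex_words).
Proof.
rewrite mem_vertex_words /QI_string.
have -> : head true (word v) = bit (tnth v ord0).
  by rewrite -nth_word; have := size_word v; case: (word v).
have -> : ~~ bit (tnth v ord0) = (tnth v ord0 == ord0).
  by case: (tnth v ord0) => [[|[]]].
congr (_ && _).
have cntD : count_mem true (word v) + count_mem false (word v) = 8.
  by rewrite count_bits size_word.
apply/forallP/andP => [ge4 | [/eqP Et /eqP Ef] a].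
  have := ge4 (unbit true); have := ge4 (unbit false).
  rewrite -!count_word !unbitK => gef get.
  split; rewrite eqn_leq ?gef ?get andbT.
    by rewrite -(leq_add2r (count_mem false (word v))) cntD (leq_add2l 4 4).
  by rewrite -(leq_add2l (count_mem true (word v))) cntD (leq_add2r 4 4).
by rewrite -count_word; case: (bit a); rewrite ?Et ?Ef.
Qed.

Definition vword (x : QI_vertex) : bitseq := word (val x).

Lemma vword_inj : injective vword.
Proof. by move=> x y /word_inj /val_inj. Qed.

Lemma vword_in x : vword x \in vertex_words.
Proof. by rewrite -QI_stringE; apply: valP. Qed.

Lemma vword_onto w : w \in vertex_words -> exists x, vword x = w.
Proof.
move=> w_in; have sz_w : size (map unbit w) == 8.
  move: w_in; rewrite size_map mem_vertex_words => /and3P[_ /eqP Et /eqP Ef].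
  by rewrite -count_bits Et Ef.
have wordE : word (Tuple sz_w) = w by exact: (mapK unbitK).
have QIw : QI_string (Tuple sz_w) by rewrite QI_stringE wordE.
by exists (Sub (Tuple sz_w) QIw); rewrite /vword SubK.
Qed.

(** * Hyperedges *)

Definition qi_words (w1 w2 w3 : bitseq) : bool :=
  all (fun g1 => all (fun g2 => all (fun g3 =>
    has (fun j => [&& nth false w1 j == g1, nth false w2 j == g2
                    & nth false w3 j == g3]) (iota 0 8))
    [:: false; true]) [:: false; true]) [:: false; true].

Lemma qi_wordsP w1 w2 w3 :
  reflect (forall g1 g2 g3, exists2 j, j < 8 &
             [/\ nth false w1 j = g1, nth false w2 j = g2
               & nth false w3 j = g3])
          (qi_words w1 w2 w3).
Proof.
have bitsP (g : bool) : g \in [:: false; true] by case: g.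
apply: (iffP idP) => [qi g1 g2 g3 | qi].
  have /allP/(_ _ (bitsP g1))/allP/(_ _ (bitsP g2)) := qi.
  move/allP/(_ _ (bitsP g3))/hasP => [j j_in /and3P[/eqP ? /eqP ? /eqP ?]].
  by exists j => //; rewrite mem_iota in j_in.
apply/allP => g1 _; apply/allP => g2 _; apply/allP => g3 _; apply/hasP.
have [j lt_j8 [E1 E2 E3]] := qi g1 g2 g3.
by exists j; rewrite ?mem_iota // E1 E2 E3 !eqxx.
Qed.

Lemma qual_indep3E v1 v2 v3 :
  qual_indep3 v1 v2 v3 = qi_words (word v1) (word v2) (word v3).
Proof.
apply/idP/qi_wordsP => [/forallP qi g1 g2 g3 | qi].
  have /forallP/(_ (unbit g2))/forallP/(_ (unbit g3)) := qi (unbit g1).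
  case/existsP=> j /and3P[/eqP E1 /eqP E2 /eqP E3].
  by exists j => //; rewrite !nth_word E1 E2 E3 !unbitK.
apply/forallP => g1; apply/forallP => g2; apply/forallP => g3; apply/existsP.
have [j lt_j8 [E1 E2 E3]] := qi (bit g1) (bit g2) (bit g3).
exists (Ordinal lt_j8).
by rewrite -!(inj_eq (can_inj bitK)) -!nth_word /= E1 E2 E3 !eqxx.
Qed.

Lemma qi_words_perm w1 w2 w3 :
  qi_words w1 w2 w3 -> qi_words w2 w1 w3 /\ qi_words w1 w3 w2.
Proof.
move/qi_wordsP => qi; split; apply/qi_wordsP => g1 g2 g3.
  by have [j ltj [? ? ?]] := qi g2 g1 g3; exists j.
by have [j ltj [? ? ?]] := qi g1 g3 g2; exists j.
Qed.

Lemma qi_words_neq w1 w2 w3 : qi_words w1 w2 w3 -> w1 != w2.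
Proof.
move/qi_wordsP/(_ false true false) => [j _ [E1 E2 _]].
by apply/eqP => E; rewrite -E E1 in E2.
Qed.

(** The cardinality condition on hyperedges costs nothing: qualitatively
independent words are distinct, as the first two must take the symbols 0 and 1
at a common position, and independence is symmetric in the three words. *)
Lemma in_common_edge x y : x != y ->
  [exists e in QI3_8_2, (x \in e) && (y \in e)] =
  has (qi_words (vword x) (vword y)) vertex_words.
Proof.
move=> neq_xy; apply/existsP/hasP => [[e] | [w w_in]].
  case/and3P; rewrite inE => /andP[_ /existsP[v1 /existsP[v2 /existsP[v3]]]].
  case/andP=> /eqP->; rewrite qual_indep3E -!/(vword _) => qi123.
  have [qi213 qi132] := qi_words_perm _ _ _ qi123.
  have [_ qi231] := qi_words_perm _ _ _ qi213.
  have [qi312 _] := qi_words_perm _ _ _ qi132.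
  have [qi321 _] := qi_words_perm _ _ _ qi231.
  rewrite !inE -!orbA.
  case/or3P=> /eqP Ex; case/or3P=> /eqP Ey; move: neq_xy;
    rewrite Ex Ey ?eqxx // => _;
    by [exists (vword v3); first exact: vword_in
       |exists (vword v2); first exact: vword_in
       |exists (vword v1); first exact: vword_in].
have [z <- qi] := vword_onto _ w_in.
exists [set x; y; z]; rewrite !inE !eqxx orbT /= andbT.
have [_ qi'] := qi_words_perm _ _ _ qi.
have [/qi_words_perm[_ qi''] _] := qi_words_perm _ _ _ qi.
have neq_xz : x != z by apply: contraNneq (qi_words_neq _ _ _ qi') => ->.
have neq_yz : y != z by apply: contraNneq (qi_words_neq _ _ _ qi'') => ->.
rewrite setUC cardsU1 !inE cards2 neq_xy ![z == _]eq_sym.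
rewrite (negPf neq_xz) (negPf neq_yz) /= setUC.
apply/existsP; exists x; apply/existsP; exists y; apply/existsP; exists z.
by rewrite eqxx qual_indep3E.
Qed.

(** * Fifteen families of affine functions *)

(** Position j stands for the point of F_2^3 given by the binary digits of j,
and an affine function is determined by its values at the origin 0 and at the
basis vectors 1, 2 and 4; these words form the Reed-Muller code RM(1,3). *)
Definition affine_word (w : bitseq) : bool :=
  let f := nth false w in
  all (fun j => f j == f 0 (+) (odd j && (f 0 (+) f 1))
                           (+) (odd j./2 && (f 0 (+) f 2))
                           (+) (odd j./2./2 && (f 0 (+) f 4))) (iota 0 8).

Definition rotate (i : nat * nat) (w : bitseq) : bitseq :=
  rot i.1 (take 3 w) ++ rot i.2 (drop 3 w).

Definition rotations : seq (nat * nat) :=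
  [seq (a, b) | a <- iota 0 3, b <- iota 0 5].

Definition family (i : nat * nat) (w : bitseq) : bool :=
  affine_word (rotate i w).

(** These are the three points on a line of PG(3,2). *)
Lemma three_families :
  all (fun w => count (family^~ w) rotations == 3) vertex_words.
Proof. by vm_compute. Qed.

(** The third string comes from an affine function outside the span of the
constants and the two given ones, complemented if its first entry is 1. *)
Lemma family_common_edge :
  all (fun i => let F := [seq w <- vertex_words | family i w] in
         all (fun u => all (fun v =>
           (u == v) || has (qi_words u v) vertex_words) F) F) rotations.
Proof. by vm_compute. Qed.

Lemma family_meets_le1 (S : {set QI_vertex}) i :
  strongly_independent QI3_8_2 S -> i \in rotations ->
  #|[set x in S | family i (vword x)]| <= 1.
Proof.
move=> indS i_in; apply/card_le1_eqP => x y; rewrite !inE.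
move=> /andP[xS Fx] /andP[yS Fy]; apply/eqP/negPn/negP => neq_yx.
have /forall_inP/(_ y yS)/forall_inP/(_ x xS)/implyP/(_ neq_yx) := indS.
rewrite in_common_edge // => /negP; apply.
have /allP/(_ i i_in) := family_common_edge.
move=> /allP/(_ (vword y)); rewrite mem_filter Fy vword_in => /(_ isT).
move=> /allP/(_ (vword x)); rewrite mem_filter Fx vword_in => /(_ isT).
by rewrite (inj_eq vword_inj) (negPf neq_yx).
Qed.

Lemma strongly_independent_le5 (S : {set QI_vertex}) :
  strongly_independent QI3_8_2 S -> #|S| <= 5.
Proof.
move=> indS; rewrite -(leq_pmul2r (isT : 0 < 3)) -sum_nat_const.
have -> : \sum_(x in S) 3 =
          \sum_(i <- rotations) #|[set x in S | family i (vword x)]|.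
  transitivity (\sum_(x in S) \sum_(i <- rotations) family i (vword x)).
    apply: eq_bigr => x _; rewrite -big_mkcond sum1_count.
    by have /allP/(_ _ (vword_in x))/eqP := three_families.
  rewrite exchange_big; apply: eq_bigr => i _ /=.
  by rewrite -big_mkcondr sum1dep_card; apply: eq_card => x; rewrite !inE.
apply: (@leq_trans (\sum_(i <- rotations) 1)); last by rewrite sum1_size.
rewrite [leqLHS]big_seq [leqRHS]big_seq; apply: leq_sum => i.
exact: family_meets_le1.
Qed.

(** * Five vertices with three common zeros *)

Definition five_words : seq bitseq :=
  [seq nseq 3 false ++ mkseq (fun j => j != k) 5 | k <- iota 0 5].

(** The zeros of two of these words meet in the positions 0, 1, 2, so that the
symbol pair (1,0) occurs at a single position. *)
Lemma five_words_no_common_edge :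
  all (fun u => all (fun v =>
    (u == v) || ~~ has (qi_words u v) vertex_words) five_words) five_words.
Proof. by vm_compute. Qed.

Definition five_vertices : {set QI_vertex} :=
  [set x | vword x \in five_words].

Lemma card_five_vertices : #|five_vertices| = 5.
Proof.
rewrite cardE -(size_map vword) -[5]/(size five_words).
apply: perm_size; apply: uniq_perm; first by rewrite map_inj_uniq ?enum_uniq //;
  exact: vword_inj.
  by vm_compute.
move=> w; apply/mapP/idP => [[x] | w5]; first by rewrite mem_enum inE => ? ->.
have w_in : w \in vertex_words.
  by move: w w5; apply/allP; vm_compute.
by have [x Ex] := vword_onto _ w_in; exists x; rewrite // mem_enum inE Ex.
Qed.

Lemma five_vertices_independent :
  strongly_independent QI3_8_2 five_vertices.
Proof.
apply/forall_inP => x; rewrite inE => x5; apply/forall_inP => y.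
rewrite inE => y5; apply/implyP => neq_xy; rewrite in_common_edge //.
have /allP/(_ _ x5)/allP/(_ _ y5) := five_words_no_common_edge.
by rewrite (inj_eq vword_inj) (negPf neq_xy).
Qed.

Theorem corollary3 : strong_independence_number QI3_8_2 = 5.
Proof.
apply/eqP; rewrite eqn_leq; apply/andP; split.
  by apply/bigmax_leqP => S; apply: strongly_independent_le5.
rewrite -[leqLHS]card_five_vertices.
exact: (leq_bigmax_cond _ five_vertices_independent).
Qed.
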